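(* Let $f_1,\dots,f_n:\mathbb{R}^d\to\mathbb{R}$ be convex, let $F=\sum_{i=1}^nf_i$, and assume that the solution set $\mathcal{W}^*=\arg\min_{\mathbf{w}\in\mathbb{R}^d}F(\mathbf{w})$ is non-empty and that for each $i\in[n]$ there is a finite constant $L_i$ such that $\|\mathbf{g}\|\le L_i$ for all $\mathbf{w}\in\mathbb{R}^d$ and all $\mathbf{g}\in\partial f_i(\mathbf{w})$. Let $\mathcal{G}=([n],\mathcal{E})$ be a connected communication graph and consider the subgradient method $$W(t+1)=A(t,X(t))X(t),\qquad X(t+1)=W(t+1)-\alpha(t+1)G(t+1),\qquad t\ge0,$$ where the averaging matrices $A(t,X(t))$ are based solely on one of the following schemes: Local Max-Gossip, (Global) Max-Gossip, or Load-Balancing averaging. Assume the step-sizes $\alpha(t)>0$ form a non-increasing sequence with $\sum_{t=1}^\infty\alpha(t)=\infty$ and $\sum_{t=1}^\infty\alpha^2(t)<\infty$. Then for every initial condition $X(0)\in\mathbb{R}^{n\times d}$, almost surely there is a (possibly sample-path dependent) $\mathbf{w}^*\in\mathcal{W}^*$ such that $$\lim_{t\to\infty}\mathbf{w}_i(t)=\mathbf{w}^*\quad\text{for all }i\in[n].$$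
   Context: $[n]=\{1,\dots,n\}$, $n\ge2$; the graph is undirected; $\mathcal{N}_i=\{j:\{i,j\}\in\mathcal{E}\}$. $X(t)\in\mathbb{R}^{n\times d}$ has $i$-th row $\mathbf{x}_i(t)^T$, $W(t)$ has $i$-th row $\mathbf{w}_i(t)^T$, and $G(t)$ has $i$-th row $\mathbf{g}_i(t)^T$, where $\mathbf{g}_i(t)\in\partial f_i(\mathbf{w}_i(t))$ is a subgradient of $f_i$ at $\mathbf{w}_i(t)$ (convex subdifferential). Norms are Euclidean. For an edge $e=\{i,j\}$, let $B(e)=I-\frac12(\mathbf{b}_i-\mathbf{b}_j)(\mathbf{b}_i-\mathbf{b}_j)^T$, where $\mathbf{b}_i$ is the $i$-th standard basis vector of $\mathbb{R}^n$ (agents $i$ and $j$ replace their states by their average, the others are unchanged). Max-Gossip: $A(t,X(t))=B(e_{\max}(X(t)))$, where $e_{\max}(X)=\arg\max_{\{i,j\}\in\mathcal{E}}\|\mathbf{x}_i-\mathbf{x}_j\|$, ties broken by the lexicographically smallest index pair. Local Max-Gossip: $A(t,X(t))=B(\{s(t),r_{s(t)}(X(t))\})$, where $\{s(t)\}$ is an i.i.d. sequence uniform on $[n]$ (with $s(t)$ independent of the past up to and including $X(t)$), and $r_s(X)=\arg\max_{r\in\mathcal{N}_s}\|\mathbf{x}_s-\mathbf{x}_r\|$, ties broken by smallest index. Load-Balancing: $A(t,X(t))X(t)$ is the result of the following synchronous round applied to $X(t)$. (1) Each agent sends its state to its neighbors. (2) Each agent $i$ computes $\mathcal{S}_i=\arg\max_{j\in\mathcal{N}_i}\|\mathbf{x}_i-\mathbf{x}_j\|$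 (the set of all maximizers) and sends an averaging request to every agent in $\mathcal{S}_i$. (3) Each agent $i$ considers the requests it received from agents in $\mathcal{S}_i$; if there is exactly one, it sends an acknowledgement to that agent; if there are several, it sends an acknowledgement to one of them chosen uniformly at random (choices independent across agents and of the past). (4) If agent $i$ both sends an acknowledgement to and receives an acknowledgement from agent $j$, then it updates $\mathbf{x}_i\leftarrow(\mathbf{x}_i+\mathbf{x}_j)/2$; otherwise its state is unchanged. *)

(* Defs.v *)
From HB Require Import structures.
From mathcomp Require Export all_boot all_order all_algebra.
From mathcomp Require Export all_classical all_reals all_analysis.
Export Order.TTheory GRing.Theory Num.Theory numFieldNormedType.Exports.

Set Implicit Arguments.
Unset Strict Implicit.
Unset Printing Implicit Defensive.

#[global] Open Scope classical_set_scope.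
#[global] Open Scope ring_scope.

Section Euclidean.
Context {R : realType} {d : nat}.
Implicit Types (f : 'rV[R]_d -> R) (u v w g : 'rV[R]_d).

Definition dotv u v : R := \sum_(k < d) u 0 k * v 0 k.

(* The library norm on matrices is the sup norm, hence this definition. *)
Definition enorm v : R := Num.sqrt (dotv v v).

Definition subdiff f w : set 'rV[R]_d :=
  [set g | forall v, f w + dotv g (v - w) <= f v].

Definition argmin f : set 'rV[R]_d := [set w | forall v, f w <= f v].

End Euclidean.

(* Agents are numbered from 0: they are the elements of 'I_n.  A graph is a
   symmetric irreflexive relation E on 'I_n. *)
Section Schemes.
Context {R : realType} {n d : nat}.
Implicit Types (E : rel 'I_n) (X : 'M[R]_(n, d)) (i j r s : 'I_n).

Definition sdist X i j : R := enorm (row i X - row j X).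

Definition bvec i : 'cV[R]_n := delta_mx i 0.

Definition avg_mx i j : 'M[R]_n :=
  1%:M - 2^-1 *: ((bvec i - bvec j) *m (bvec i - bvec j)^T).

(* An edge is represented by its pair of endpoints in increasing order;
   is_emax holds of exactly one pair when E has an edge. *)
Definition is_emax E X i j : Prop :=
  [/\ (i < j)%N, E i j,
      forall k l : 'I_n, (k < l)%N -> E k l -> sdist X k l <= sdist X i j &
      forall k l : 'I_n, (k < l)%N -> E k l -> sdist X k l = sdist X i j ->
        (i < k)%N \/ (i = k /\ (j <= l)%N)].

Definition is_rmax E X s r : Prop :=
  [/\ E s r,
      forall k, E s k -> sdist X s k <= sdist X s r &
      forall k : 'I_n, E s k -> sdist X s k = sdist X s r -> (r <= k)%N].

Definition farthest E X i : {set 'I_n} :=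
  [set j | E i j && [forall k, E i k ==> (sdist X i k <= sdist X i j)]]%SET.

(* Requests which agent i considers: those received from its own maximizers. *)
Definition requests E X i : {set 'I_n} :=
  [set j in farthest E X i | i \in farthest E X j]%SET.

(* Conditional probability that agent i's acknowledgement is a, given that the
   states are X; a = None means that agent i sends no acknowledgement. *)
Definition ack_prob E X i (a : option 'I_n) : R :=
  if a is Some j then (j \in requests E X i)%:R / #|requests E X i|%:R
  else (#|requests E X i| == 0)%N%:R.

Definition lb_update (a : {ffun 'I_n -> option 'I_n}) X : 'M[R]_(n, d) :=
  \matrix_(i, k)
    if a i is Some j then
      if a j == Some i then (X i k + X j k) / 2 else X i k
    else X i k.

End Schemes.

Section Processes.
Context {R : realType} {n d : nat} {disp : measure_display}
  {T : measurableType disp}.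
Variables (P : probability T R) (E : rel 'I_n).
Variables (X : nat -> T -> 'M[R]_(n, d)) (A : nat -> T -> 'M[R]_n).

(* The past at time t: the sigma-algebra generated by X(0), ..., X(t) and by
   the random choices c(0), ..., c(t - 1). *)
Definition past (C : Type) (c : nat -> T -> C) (t : nat) : set (set T) :=
  <<s [set H | exists k i j (B : set (measurableTypeR R)),
         [/\ (k <= t)%N, measurable B & H = (fun w => X k w i j) @^-1` B]]
      `|` [set H | exists k u, (k < t)%N /\ H = c k @^-1` [set u]] >>.

Definition max_gossip : Prop :=
  forall t w, exists i j, is_emax E (X t w) i j /\ A t w = avg_mx i j.

(* Since the past at time t contains s(0), ..., s(t - 1), the third condition
   includes the mutual independence of the sequence s. *)
Definition local_max_gossip : Prop :=
  exists s : nat -> T -> 'I_n,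
    [/\ forall t i, measurable (s t @^-1` [set i]),
        forall t i, P (s t @^-1` [set i]) = (n%:R^-1)%:E,
        forall t i H, past s t H ->
          P (H `&` s t @^-1` [set i]) = (P H * P (s t @^-1` [set i]))%E &
        forall t w, exists r,
          is_rmax E (X t w) (s t w) r /\ A t w = avg_mx (s t w) r].

(* The second condition says that, conditionally on the past, the
   acknowledgements of the agents at time t are independent, that of agent i
   having law ack_prob E (X t) i. *)
Definition load_balancing : Prop :=
  exists ack : nat -> T -> {ffun 'I_n -> option 'I_n},
    [/\ forall t a, measurable (ack t @^-1` [set a]),
        forall t a H, past ack t H ->
          P (H `&` ack t @^-1` [set a]) =
          (\int[P]_(w in H) (\prod_(i < n) ack_prob E (X t w) i (a i))%:E)%E &
        forall t w, A t w *m X t w = lb_update (ack t w) (X t w)].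

End Processes.

(* Main.v *)
From mathcomp Require Import perm ring lra measurable_realfun.
Require Import Defs.

Set Implicit Arguments.
Unset Strict Implicit.
Unset Printing Implicit Defensive.

(** The proof measures consensus by the disagreement
    V(X) = sum_i |x_i - xbar|^2, where xbar is the mean of the rows of X.

    In each scheme a round replaces X by (X + X o s) / 2 for an involution s of
    the agents ([avg_mx_mixing], [lb_update_mixing]).  Such a round keeps xbar
    and lowers V by a quarter of sum_i |x_i - x_(s i)|^2
    ([mixing_disagreement]).  The graph being connected, V(X) is at most a
    constant times the squared length of a longest edge, so a round that
    averages across a longest edge multiplies V by at most 1 - delta
    ([mixing_contracts]).  Global Max-Gossip does this in every round.  In the
    two random schemes, whatever the past, a longest edge is averaged with
    conditional probability at least some p > 0: Local Max-Gossip may draw an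
    endpoint of it, and in Load-Balancing its two endpoints request each other
    and may acknowledge each other ([scheme_contracting]).

    Taking expectations, with c bounding the effect of the subgradients,
    E V(t+1) <= (1 - (delta p)^2) E V(t) + c alpha(t+1)^2.
    Since sum alpha^2 is finite, so is sum_t E V(t), hence sum_t V(t) is finite
    almost surely ([ae_summable]).

    The rest concerns one sample path along which sum_t V(t) is finite.  The
    mean makes a subgradient step whose subgradients are taken at the w_i
    instead of at xbar.  By Young's inequality this costs only multiples of
    alpha^2 and of V: for every minimizer z,
    |xbar(t+1) - z|^2 <= |xbar(t) - z|^2
      - (2 alpha / n) (F(xbar(t)) - F(z)) + e(t)
    with sum e finite ([subgradient_step]).  As sum alpha is infinite,
    F(xbar(t)) comes arbitrarily close to the minimum infinitely often; a
    cluster point of such near-minimizing means is a minimizer, and the same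
    inequality for that minimizer turns clustering into convergence
    ([quasi_fejer_cvg]).  Finally w_i - xbar tends to 0 because V does.

    Comparing the values f_i(w_i) with f_i(xbar) uses subgradients of f_i at
    xbar; they exist by the finite-dimensional Hahn-Banach argument of
    [subdiff_nonempty]. *)

(** * The squared Euclidean norm *)
Section SquaredNorm.
Context {R : realType} {d : nat}.
Implicit Types (u v w g : 'rV[R]_d) (a e : R).

Definition sqn v : R := dotv v v.

Lemma dotvDl u v w : dotv (u + v) w = dotv u w + dotv v w.
Proof. by rewrite -big_split; apply: eq_bigr => k _; rewrite mxE mulrDl. Qed.

Lemma dotvC u v : dotv u v = dotv v u.
Proof. by apply: eq_bigr => k _; rewrite mulrC. Qed.

Lemma dotvDr u v w : dotv w (u + v) = dotv w u + dotv w v.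
Proof. by rewrite dotvC dotvDl !(dotvC w). Qed.

Lemma dotvZl a u v : dotv (a *: u) v = a * dotv u v.
Proof. by rewrite mulr_sumr; apply: eq_bigr => k _; rewrite mxE mulrA. Qed.

Lemma dotvZr a u v : dotv v (a *: u) = a * dotv v u.
Proof. by rewrite dotvC dotvZl dotvC. Qed.

Lemma dotvNl u v : dotv (- u) v = - dotv u v.
Proof. by rewrite -scaleN1r dotvZl mulN1r. Qed.

Lemma dotvNr u v : dotv u (- v) = - dotv u v.
Proof. by rewrite dotvC dotvNl dotvC. Qed.

Lemma dotv0 u : dotv u 0 = 0.
Proof. by rewrite -(scale0r u) dotvZr mul0r. Qed.

Lemma dotv_suml (I : finType) (F : I -> 'rV[R]_d) v :
  dotv (\sum_i F i) v = \sum_i dotv (F i) v.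
Proof.
by elim/big_ind2: _ => [|x a y b <- <-|//]; rewrite ?dotvDl // dotvC dotv0.
Qed.

Lemma sqn_ge0 v : 0 <= sqn v.
Proof. by apply: sumr_ge0 => k _; rewrite -expr2 sqr_ge0. Qed.

Lemma enorm_sqn v : enorm v ^+ 2 = sqn v.
Proof. by rewrite sqr_sqrtr // sqn_ge0. Qed.

Lemma sqnD u v : sqn (u + v) = sqn u + 2 * dotv u v + sqn v.
Proof. by rewrite /sqn dotvDl !dotvDr (dotvC v u); ring. Qed.

Lemma sqnN v : sqn (- v) = sqn v.
Proof. by rewrite /sqn dotvNl dotvNr opprK. Qed.

Lemma sqnB u v : sqn (u - v) = sqn u - 2 * dotv u v + sqn v.
Proof. by rewrite sqnD sqnN dotvNr mulrN. Qed.

Lemma sqn_subC u v : sqn (u - v) = sqn (v - u).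
Proof. by rewrite -sqnN opprB. Qed.

Lemma sqnZ a v : sqn (a *: v) = a ^+ 2 * sqn v.
Proof. by rewrite /sqn dotvZl dotvZr mulrA expr2. Qed.

Lemma entry_le_sqn v k : v 0 k ^+ 2 <= sqn v.
Proof.
rewrite /sqn /dotv (bigD1 k) //= -expr2 lerDl.
by apply: sumr_ge0 => j _; rewrite -expr2 sqr_ge0.
Qed.

(** The expansion of 0 <= |e u - v|^2, divided by e.  Every cross term of the
    proof is split with it, the weight e being chosen at each use. *)
Lemma young e u v : 0 < e -> 2 * dotv u v <= e * sqn u + e^-1 * sqn v.
Proof.
move=> e0; have := sqn_ge0 (e *: u - v).
rewrite sqnB sqnZ dotvZl -(pmulr_rge0 _ (x := e^-1)) ?invr_gt0 //.
have ne : e != 0 by rewrite gt_eqF.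
by rewrite mulrDr mulrBr expr2 !mulrA (mulrC _ 2) -!mulrA !mulKf //; lra.
Qed.

Lemma sqnD_le e u v : 0 < e ->
  sqn (u + v) <= (1 + e) * sqn u + (1 + e^-1) * sqn v.
Proof. by move=> e0; have := young u v e0; rewrite sqnD; lra. Qed.

Lemma sqnD_le2 u v : sqn (u + v) <= 2 * sqn u + 2 * sqn v.
Proof. by have := @sqnD_le 1 u v ltr01; rewrite invr1. Qed.

End SquaredNorm.

(** * Disagreement and pairwise averaging *)
Section Disagreement.
Context {R : realType} {n d : nat}.
Hypothesis n_gt0 : (0 < n)%N.
Implicit Types (X W G : 'M[R]_(n, d)) (s : 'I_n -> 'I_n).

Definition xbar X : 'rV[R]_d := n%:R^-1 *: \sum_i row i X.

Definition disagreement X : R := \sum_i sqn (row i X - xbar X).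

Let nR0 : (n%:R : R) != 0. Proof. by rewrite pnatr_eq0 -lt0n. Qed.

Lemma disagreement_ge0 X : 0 <= disagreement X.
Proof. by apply: sumr_ge0 => i _; exact: sqn_ge0. Qed.

Lemma sum_row X : \sum_i row i X = n%:R *: xbar X.
Proof. by rewrite scalerA divff // scale1r. Qed.

(** The cross terms cancel because the deviations from the mean sum to 0. *)
Lemma sum_sqn_shift X c :
  \sum_i sqn (row i X - c) = disagreement X + n%:R * sqn (xbar X - c).
Proof.
have e i : sqn (row i X - c) = sqn (row i X - xbar X)
    + 2 * dotv (row i X - xbar X) (xbar X - c) + sqn (xbar X - c).
  by rewrite -sqnD addrA subrK.
rewrite (eq_bigr _ (fun i _ => e i)) !big_split /= -mulr_sumr -dotv_suml.
rewrite sumrB sum_row sumr_const card_ord scaler_nat subrr dotvC dotv0.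
by rewrite mulr0 addr0 sumr_const card_ord mulr_natl.
Qed.

Lemma sum_sqn X : \sum_i sqn (row i X) = disagreement X + n%:R * sqn (xbar X).
Proof.
rewrite -[xbar X]subr0 -sum_sqn_shift.
by under [RHS]eq_bigr do rewrite subr0.
Qed.

Lemma sqn_xbar_le X : n%:R * sqn (xbar X) <= \sum_i sqn (row i X).
Proof. by rewrite sum_sqn lerDr disagreement_ge0. Qed.

Lemma disagreement_le_sum_sqn X c : disagreement X <= \sum_i sqn (row i X - c).
Proof. by rewrite sum_sqn_shift lerDl mulr_ge0 ?sqn_ge0. Qed.

Lemma xbarD X Y : xbar (X + Y) = xbar X + xbar Y.
Proof.
rewrite /xbar -scalerDr -big_split; congr (_ *: _).
by apply: eq_bigr => i _; rewrite linearD.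
Qed.

Lemma xbarZ (a : R) X : xbar (a *: X) = a *: xbar X.
Proof.
rewrite /xbar scalerA mulrC -scalerA; congr (_ *: _).
by rewrite scaler_sumr; apply: eq_bigr => i _; rewrite linearZ.
Qed.

(** The disagreement is the square of a seminorm, bounded by the Euclidean norm
    of the whole matrix; the parameter e lets the factor in front of
    disagreement W be as close to 1 as the contraction requires. *)
Lemma disagreement_step (e a : R) W G : 0 < e ->
  disagreement (W - a *: G) <=
    (1 + e) * disagreement W + (1 + e^-1) * a ^+ 2 * \sum_i sqn (row i G).
Proof.
move=> e0; apply: (@le_trans _ _
  ((1 + e) * disagreement W + (1 + e^-1) * a ^+ 2 * disagreement G)).
  rewrite /disagreement !mulr_sumr -big_split; apply: ler_sum => i _ /=.
  have -> : row i (W - a *: G) - xbar (W - a *: G)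
      = (row i W - xbar W) + (- a) *: (row i G - xbar G).
    rewrite -scaleNr xbarD xbarZ; move: (xbar W) (xbar G) => w g.
    by apply/rowP => k; rewrite !mxE; ring.
  by apply: (le_trans (sqnD_le _ _ e0)); rewrite sqnZ sqrrN mulrA.
rewrite lerD2l; apply: ler_wpM2l.
  by apply: mulr_ge0; rewrite ?sqr_ge0 ?addr_ge0 ?invr_ge0 ?(ltW e0).
by rewrite sum_sqn lerDl mulr_ge0 ?sqn_ge0.
Qed.

(** The common form of a round of all three schemes.  The agents that keep their
    state are the fixed points of s, so that they need no separate treatment. *)
Definition mixing s X W : Prop :=
  involutive s /\ forall i k, W i k = (X i k + X (s i) k) / 2.

Lemma mixing_row s X W i : mixing s X W ->
  row i W = 2^-1 *: (row i X + row (s i) X).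
Proof. by move=> [_ sW]; apply/rowP => k; rewrite !mxE sW mulrC. Qed.

Lemma mixing_xbar s X W : mixing s X W -> xbar W = xbar X.
Proof.
move=> sW; rewrite /xbar; congr (_ *: _).
rewrite (eq_bigr _ (fun i _ => mixing_row i sW)) -scaler_sumr big_split /=.
have -> : \sum_i row (s i) X = \sum_i row i X.
  by rewrite [RHS](reindex_inj (inv_inj sW.1)).
rewrite -mulr2n.
by rewrite -[X in _ *: X]scaler_nat scalerA mulVf ?pnatr_eq0 // scale1r.
Qed.

(** The mean is unchanged, and |(x + y) / 2|^2 is the mean of |x|^2 and |y|^2
    minus |x - y|^2 / 4. *)
Lemma mixing_disagreement s X W : mixing s X W ->
  disagreement W = disagreement X - 4^-1 * \sum_i sqn (row i X - row (s i) X).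
Proof.
move=> sW; apply: (@addIr _ (n%:R * sqn (xbar X))).
rewrite -{1}(mixing_xbar sW) addrAC -!sum_sqn.
have e i : sqn (row i W) = 2^-1 * sqn (row i X) + 2^-1 * sqn (row (s i) X)
    - 4^-1 * sqn (row i X - row (s i) X).
  by rewrite (mixing_row i sW) sqnZ sqnD sqnB; lra.
rewrite (eq_bigr _ (fun i _ => e i)) sumrB big_split /= -!mulr_sumr.
have -> : \sum_i sqn (row (s i) X) = \sum_i sqn (row i X).
  by rewrite [RHS](reindex_inj (inv_inj sW.1)).
lra.
Qed.

Lemma mixing_disagreement_le s X W : mixing s X W ->
  disagreement W <= disagreement X.
Proof.
move=> sW; rewrite (mixing_disagreement sW) gerBl mulr_ge0 // ?invr_ge0 //.
by apply: sumr_ge0 => i _; exact: sqn_ge0.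
Qed.

End Disagreement.

Section Mixings.
Context {R : realType} {n d : nat}.
Implicit Types (X : 'M[R]_(n, d)).

Lemma avg_mx_mixing X i j : mixing (tperm i j) X (avg_mx i j *m X).
Proof.
split; first exact: tpermK.
move=> k l; rewrite /avg_mx mulmxBl mul1mx -scalemxAl -mulmxA.
have -> : (bvec i - bvec j)^T *m X = row i X - row j X :> 'rV[R]_d.
  by rewrite linearB mulmxBl /= /bvec !trmx_delta -!rowE.
rewrite !mxE big_ord1 !mxE !eqxx !andbT.
case: tpermP => [->|->|/eqP ki /eqP kj].
- by have [->|ij] := eqVneq i j; rewrite ?eqxx /=; lra.
- by have [->|ij] := eqVneq j i; rewrite ?eqxx /=; lra.
- by rewrite (negbTE ki) (negbTE kj); lra.
Qed.

Definition partner (a : {ffun 'I_n -> option 'I_n}) i : 'I_n :=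
  if a i is Some j then (if a j == Some i then j else i) else i.

(** Two agents average exactly when each acknowledges the other; reading this
    off an arbitrary acknowledgement pattern gives an involution, even for the
    patterns of probability 0. *)
Lemma lb_update_mixing a X : mixing (partner a) X (lb_update a X).
Proof.
split=> [i|i k]; rewrite ?mxE /partner.
  case ai: (a i) => [j|]; last by rewrite ai.
  by have [aj|aj] := eqVneq (a j) (Some i); rewrite ?aj ai ?eqxx // (negbTE aj).
case: (a i) => [j|]; last lra.
case: eqP => _ //; lra.
Qed.

End Mixings.

(** * Averaging along a longest edge contracts the disagreement *)
Section OrderInvariance.
Context {R : realType} {n d : nat}.
Implicit Types X Y : 'M[R]_(n, d).

(** The choices of all schemes depend on the state only through the comparisons
    between pairs of distances.  These comparisons take finitely many values,
    which makes every event about the choices measurable. *)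
Definition same_order X Y : Prop :=
  forall i j k l, (sdist X i j <= sdist X k l) = (sdist Y i j <= sdist Y k l).

Definition order_invariant (Q : 'M[R]_(n, d) -> Prop) : Prop :=
  forall X Y, same_order X Y -> Q X -> Q Y.

Lemma ack_prob_same_order E X Y i a :
  same_order X Y -> ack_prob E X i a = ack_prob E Y i a.
Proof.
move=> XY; have farE k : farthest E X k = farthest E Y k.
  apply/setP => j; rewrite !inE; congr (_ && _).
  by apply: eq_forallb => l; rewrite XY.
have reqE : requests E X i = requests E Y i.
  by apply/setP => j; rewrite finset.in_set [RHS]finset.in_set !farE.
by rewrite /ack_prob reqE.
Qed.

Lemma sdist_le X i j k l :
  (sdist X i j <= sdist X k l) =
  (sqn (row i X - row j X) <= sqn (row k X - row l X)).
Proof. by rewrite ler_sqrt // sqn_ge0. Qed.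

Lemma sdistC X i j : sdist X i j = sdist X j i.
Proof. by rewrite /sdist /enorm -/(sqn _) sqn_subC. Qed.

End OrderInvariance.

Section LongestEdge.
Context {R : realType} {n d : nat}.
Variable E : rel 'I_n.
Hypothesis hsym : symmetric E.
Implicit Types (X : 'M[R]_(n, d)).

Definition longest_edge X i j : Prop :=
  E i j /\ forall k l, E k l -> sdist X k l <= sdist X i j.

Lemma longest_edgeC X i j : longest_edge X i j -> longest_edge X j i.
Proof. by move=> [Eij maxE]; split; rewrite ?(sdistC X j) // hsym. Qed.

Lemma longest_edge_order_invariant i j :
  order_invariant (fun X => longest_edge X i j).
Proof. by move=> X Y XY [Eij maxE]; split=> // k l /maxE; rewrite XY. Qed.

Lemma connected_edge : (2 <= n)%N -> (forall i j, connect E i j) ->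
  exists i j, E i j.
Proof.
move=> n2 hconn; have n0 : (0 < n)%N by apply: leq_trans n2.
have := hconn (Ordinal n0) (Ordinal n2); case/connectP=> -[|k p] /=.
  by move=> _ /(congr1 val).
by case/andP=> Ek _ _; exists (Ordinal n0), k.
Qed.

Lemma longest_edge_exists X :
  (exists i j, E i j) -> exists i j, longest_edge X i j.
Proof.
move=> [i0 [j0 E0]].
have [[i j] /= Eij maxE] := @arg_maxP _ _ _ (i0, j0)
  (fun q : 'I_n * 'I_n => E q.1 q.2) (fun q => sdist X q.1 q.2) E0.
by exists i, j; split=> // k l Ekl; exact: (maxE (k, l)).
Qed.

Lemma longest_edge_farthest X i j : longest_edge X i j -> j \in farthest E X i.
Proof.
move=> [Eij maxE]; rewrite inE Eij.
by apply/forallP => k; apply/implyP; exact: maxE.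
Qed.

(** Each endpoint of a longest edge is a farthest neighbour of the other one, so
    each receives a request that it has to consider. *)
Lemma longest_edge_requests X i j : longest_edge X i j -> j \in requests E X i.
Proof.
move=> le_ij; rewrite finset.in_set; apply/andP; split.
  exact: longest_edge_farthest.
by apply: longest_edge_farthest; exact: longest_edgeC.
Qed.

Lemma ack_prob_some_ge X i j : j \in requests E X i ->
  n%:R^-1 <= ack_prob E X i (Some j).
Proof.
move=> req_j; rewrite /ack_prob req_j mul1r.
have req0 : (0 < #|requests E X i|)%N by apply/card_gt0P; exists j.
have req_n : (#|requests E X i| <= n)%N by rewrite -[leqRHS]card_ord max_card.
rewrite lef_pV2 ?posrE ?ltr0n ?ler_nat //; exact: leq_trans req_n.
Qed.

End LongestEdge.

Section Gap.
Context {R : realType} {n d : nat}.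
Variable E : rel 'I_n.
Hypothesis hconn : forall i j, connect E i j.

(** The inequality |x - y|^2 <= 2 |x - z|^2 + 2 |z - y|^2 is applied once per
    edge of the path, which accounts for the exponential factor. *)
Lemma connect_sqn_le (X : 'M[R]_(n, d)) (M : R) (p : seq 'I_n) i : 0 <= M ->
  (forall k l, E k l -> sqn (row k X - row l X) <= M) ->
  path E i p -> sqn (row i X - row (last i p) X) <= 4 ^+ size p * M.
Proof.
move=> M0 edgeM; elim: p i => [|j p IHp] i /=.
  by move=> _; rewrite subrr /sqn dotv0 mul1r.
case/andP=> Eij /IHp IH; rewrite -[row i X](subrK (row j X)) -addrA.
apply: (le_trans (sqnD_le2 _ _)); have := edgeM _ _ Eij.
have : 1 * M <= 4 ^+ size p * M by rewrite ler_wpM2r // exprn_ege1 // ler1n.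
by rewrite exprS; lra.
Qed.

Lemma connected_gap : exists2 K : R, 0 < K &
  forall (X : 'M[R]_(n, d)) (M : R), 0 <= M ->
  (forall k l, E k l -> sqn (row k X - row l X) <= M) ->
  disagreement X <= K * M.
Proof.
exists (n%:R * 4 ^+ n + 1); first by rewrite ltr_wpDl ?mulr_ge0 ?exprn_ge0.
move=> X M M0 edgeM.
have [n0|n_gt0] := posnP n.
  rewrite /disagreement big1 => [|i].
    by rewrite mulr_ge0 ?addr_ge0 ?mulr_ge0 ?exprn_ge0.
  by have := ltn_ord i; rewrite {2}n0.
pose o := Ordinal n_gt0.
apply: (le_trans (disagreement_le_sum_sqn n_gt0 X (row o X))).
have h i : sqn (row i X - row o X) <= 4 ^+ n * M.
  have /connectP[p] := hconn i o; case/shortenP=> q Eq uq _ lastq.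
  have := connect_sqn_le M0 edgeM Eq; rewrite -lastq => /le_trans; apply.
  apply: ler_wpM2r => //; rewrite ler_eXn2l ?ltr1n //.
  (* A path without repetitions has at most n vertices. *)
  apply: ltnW; have /card_uniqP/= <- := uq.
  by apply: (leq_trans (max_card _)); rewrite card_ord.
apply: (le_trans (ler_sum _ (fun i _ => h i))).
by rewrite sumr_const card_ord -[leLHS]mulr_natl mulrDl mul1r -mulrA lerDl.
Qed.

End Gap.

(** If M is the squared length of the averaged edge, then V(X) <= K M, while the
    round lowers V by at least M / 4; K + 1 instead of K keeps delta below 1. *)
Lemma mixing_contracts (R : realType) (n d : nat) (E : rel 'I_n) :
  (0 < n)%N -> (forall i j, connect E i j) ->
  exists2 delta : R, 0 < delta < 1 &
  forall (X W : 'M[R]_(n, d)) s i, mixing s X W -> longest_edge E X i (s i) ->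
    disagreement W <= disagreement X - delta * disagreement X.
Proof.
move=> n0 hconn; have [K K0 gap] := connected_gap (R := R) (d := d) hconn.
have K1 : 1 < 4 * (K + 1) by lra.
exists (4 * (K + 1))^-1.
  by apply/andP; split; rewrite ?invr_gt0 ?invf_lt1 //; lra.
move=> X W s i sW [_ maxE]; rewrite (mixing_disagreement n0 sW) lerD2l lerN2.
set M := sqn (row i X - row (s i) X).
have M0 : 0 <= M by exact: sqn_ge0.
apply: (@le_trans _ _ (4^-1 * M)); last first.
  rewrite ler_pM2l ?invr_gt0 // (bigD1 i) //= lerDl.
  by apply: sumr_ge0 => j _; exact: sqn_ge0.
have : disagreement X <= K * M.
  by apply: gap => // k l Ekl; rewrite -sdist_le; exact: maxE.
by rewrite ler_pdivrMl; lra.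
Qed.

(** * Subgradients of convex functions *)
Section Subgradient.
Context {R : realType} {d : nat}.
Variable f : 'rV[R]_d -> R.
Hypothesis f_convex : convex_function setT f.

Let convex_functionE (t : R) x y : 0 <= t -> t <= 1 ->
  f (t *: x + (1 - t) *: y) <= t * f x + (1 - t) * f y.
Proof.
move=> t0 t1; have ti : Itv.spec (@Itv.num_sem R) (Itv.Real `[0%Z, 1%Z]) t.
  by rewrite /Itv.spec /Itv.num_sem /= num_real /= in_itv /= t0 t1.
have := @f_convex (Itv.mk ti) x y; apply; exact: in_setT.
Qed.

Lemma convex_two_points (r s : R) (x y : 'rV[R]_d) : 0 < r -> 0 < s ->
  (r + s) * f ((r + s)^-1 *: (r *: x + s *: y)) <= r * f x + s * f y.
Proof.
move=> r0 s0; have rs0 : 0 < r + s by rewrite addr_gt0.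
have t0 : 0 <= r / (r + s) by rewrite divr_ge0 // ltW.
have t1 : r / (r + s) <= 1 by rewrite ler_pdivrMr // mul1r lerDl ltW.
have e : 1 - r / (r + s) = s / (r + s) by field; rewrite gt_eqF.
have := convex_functionE x y t0 t1; rewrite e -(ler_pM2l rs0).
rewrite scalerDr !scalerA ![_^-1 * _]mulrC => /le_trans; apply.
by rewrite le_eqVlt; apply/orP; left; apply/eqP; field; rewrite gt_eqF.
Qed.

Let partial_subgradient w k g :=
  forall v : 'rV[R]_d, (forall j : 'I_d, (k <= j)%N -> v 0 j = 0) ->
    f w + dotv g v <= f (w + v).

(** One step of the Hahn-Banach argument: the slopes allowed along the new axis
    lie above every lo x s and below every hi y r, and convexity gives
    lo x s <= hi y r because the point of the flat subspace between
    x - s e and y + r e is (r x + s y) / (r + s). *)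
Let extend_subgradient w (k : 'I_d) g : partial_subgradient w k g ->
  exists g', partial_subgradient w k.+1 g'.
Proof.
move=> gP; pose e : 'rV[R]_d := delta_mx 0 k.
have dot_e v : dotv e v = v 0 k.
  rewrite /dotv (bigD1 k) //= big1 => [|j jk];
    rewrite mxE !eqxx ?mul1r ?addr0 //.
  by rewrite (negbTE jk) mul0r.
pose flat (x : 'rV[R]_d) := forall j : 'I_d, (k <= j)%N -> x 0 j = 0.
pose lo (x : 'rV[R]_d) (s : R) := (f w + dotv g x - f (w + (x - s *: e))) / s.
pose hi (x : 'rV[R]_d) (s : R) := (f (w + (x + s *: e)) - f w - dotv g x) / s.
have lo_hi x y s r : flat x -> flat y -> 0 < s -> 0 < r -> lo x s <= hi y r.
  move=> fx fy s0 r0; rewrite /lo /hi ler_pdivrMr // mulrAC ler_pdivlMr //.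
  have rs0 : 0 < r + s by rewrite addr_gt0.
  have /gP : flat ((r + s)^-1 *: (r *: x + s *: y)).
    by move=> j kj; rewrite !mxE fx // fy // !mulr0 addr0 mulr0.
  rewrite -(ler_pM2l rs0) dotvZr dotvDr !dotvZr.
  rewrite mulrDr mulrA divff ?gt_eqF // mul1r.
  have := convex_two_points (w + (x - s *: e)) (w + (y + r *: e)) r0 s0.
  have -> : (r + s)^-1 *: (r *: (w + (x - s *: e)) + s *: (w + (y + r *: e)))
    = w + (r + s)^-1 *: (r *: x + s *: y).
    by apply/rowP => j; rewrite !mxE; field; rewrite gt_eqF.
  lra.
pose S := [set c | exists x s, [/\ flat x, 0 < s & c = lo x s]].
have flat0 : flat 0 by move=> j _; rewrite mxE.
have S0 : S !=set0 by exists (lo 0 1), 0, 1.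
have Shi y r : flat y -> 0 < r -> ubound S (hi y r).
  by move=> fy r0 _ [x [s [fx s0 ->]]]; exact: lo_hi.
have S_le y r : flat y -> 0 < r -> sup S <= hi y r.
  by move=> fy r0; apply: ge_sup => //; exact: Shi.
have S_ge x s : flat x -> 0 < s -> lo x s <= sup S.
  move=> fx s0; apply: ub_le_sup; last by exists x, s.
  by exists (hi 0 1); exact: Shi.
exists (g + (sup S - g 0 k) *: e) => v fv.
have fx : flat (v - v 0 k *: e).
  move=> j kj; rewrite !mxE eqxx /=; have [->|jk] := eqVneq j k.
    by rewrite mulr1 subrr.
  rewrite mulr0 subr0 fv // ltn_neqAle kj andbT.
  by apply: contraNneq jk => kj'; apply/eqP/val_inj.
set x := v - v 0 k *: e in fx.
have vE : v = x + v 0 k *: e by rewrite /x subrK.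
have -> : dotv (g + (sup S - g 0 k) *: e) v = dotv g x + v 0 k * sup S.
  rewrite dotvDl dotvZl dot_e {1}vE dotvDr dotvZr (dotvC g e) dot_e; ring.
have [v0|v0|v0] := ltrgtP (v 0 k) 0.
- have := S_ge x (- v 0 k) fx; rewrite oppr_gt0 => /(_ v0).
  rewrite /lo ler_pdivrMr ?oppr_gt0 // scaleNr opprK -vE; lra.
- have := S_le x (v 0 k) fx v0.
  rewrite /hi ler_pdivlMr // -vE; lra.
- have xv : x = v by rewrite /x v0 scale0r subr0.
  by have := gP x fx; rewrite v0 mul0r addr0 xv.
Qed.

Lemma subdiff_nonempty w : subdiff f w !=set0.
Proof.
suff /(_ d (leqnn d)) [g gP] :
    forall k, (k <= d)%N -> exists g, partial_subgradient w k g.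
  exists g => v; have := gP (v - w); rewrite addrCA subrr addr0; apply.
  by move=> j; rewrite leqNgt ltn_ord.
elim=> [_|k IHk kd].
  exists 0 => v v0; rewrite (_ : v = 0) ?dotv0 ?addr0 //.
  by apply/rowP => j; rewrite v0 // mxE.
have [g gP] := IHk (ltnW kd); exact: (@extend_subgradient w (Ordinal kd) g).
Qed.

End Subgradient.

Lemma subdiff_sum (R : realType) (d : nat) (I : finType)
    (f : I -> 'rV[R]_d -> R) (g : I -> 'rV[R]_d) w :
  (forall i, subdiff (f i) w (g i)) ->
  subdiff (fun v => \sum_i f i v) w (\sum_i g i).
Proof.
by move=> fg v; rewrite dotv_suml -big_split; apply: ler_sum => i _; exact: fg.
Qed.

(** * Series of nonnegative reals *)
Section NonnegSeries.
Context {R : realType}.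

Definition summable_nat (e : nat -> R) :=
  exists B, forall N, \sum_(0 <= t < N) e t <= B.

(** Beyond N such a sum is at most the distance from the N-th partial sum to the
    supremum of all partial sums. *)
Lemma summable_tail (e : nat -> R) (eps : R) :
  (forall t, 0 <= e t) -> summable_nat e -> 0 < eps ->
  exists N, forall s t, (N <= s)%N -> (s <= t)%N -> \sum_(s <= i < t) e i < eps.
Proof.
move=> e0 [B eB] eps0.
pose S := [set x | exists N, x = \sum_(0 <= t < N) e t].
have hS : has_sup S.
  by split; [exists 0, 0%N; rewrite big_geq | exists B => _ [N ->]].
have [_ [N ->] supN] := sup_adherent eps0 hS.
exists N => s t Ns st.
have St : \sum_(0 <= i < t) e i <= sup S.
  by apply: ub_le_sup; [exact: hS.2 | exists t].
have Nss : \sum_(0 <= i < N) e i <= \sum_(0 <= i < s) e i.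
  rewrite [leRHS](big_cat_nat _ Ns) //= lerDl.
  by apply: sumr_ge0.
move: St; rewrite (big_cat_nat _ st) //=; lra.
Qed.

Lemma summable_cvg0 (e : nat -> R) (eps : R) :
  (forall t, 0 <= e t) -> summable_nat e -> 0 < eps ->
  exists N, forall t, (N <= t)%N -> e t < eps.
Proof.
move=> e0 e_sum eps0; have [N tail] := summable_tail e0 e_sum eps0.
by exists N => t Nt; have := tail t t.+1 Nt (leqnSn t); rewrite big_nat1.
Qed.

Lemma summable_natD (a b : R) (u v : nat -> R) :
  0 <= a -> 0 <= b -> summable_nat u -> summable_nat v ->
  summable_nat (fun t => a * u t + b * v t).
Proof.
move=> a0 b0 [U uU] [V vV]; exists (a * U + b * V) => N.
by rewrite big_split -!mulr_sumr lerD // ler_wpM2l.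
Qed.

Lemma summable_natP (e : nat -> R) : (forall t, 0 <= e t) ->
  summable_nat e <-> (\sum_(0 <= t <oo) (e t)%:E < +oo)%E.
Proof.
move=> e0; have ge0 t : (0 <= t)%N -> true -> (0%E <= (e t)%:E)%E.
  by rewrite lee_fin.
split=> [[B eB]|lty].
  apply: (@le_lt_trans _ _ B%:E); last exact: ltry.
  apply: lime_le; first exact: is_cvg_nneseries.
  by apply: nearW => N; rewrite sumEFin lee_fin.
have fin : (\sum_(0 <= t <oo) (e t)%:E)%E \is a fin_num.
  by rewrite ge0_fin_numE // nneseries_ge0.
exists (fine (\sum_(0 <= t <oo) (e t)%:E)%E) => N.
by rewrite -lee_fin fineK // -sumEFin nneseries_lim_ge.
Qed.

Lemma nneseries_pinfty_unbounded (b : nat -> R) : (forall t, 0 <= b t) ->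
  (\sum_(0 <= t <oo) (b t)%:E = +oo)%E ->
  forall B, exists N, B <= \sum_(0 <= t < N) b t.
Proof.
move=> b0 boo B; apply: contrapT => nope.
have : summable_nat b.
  exists B => N; rewrite leNgt; apply/negP => /ltW le_B.
  by apply: nope; exists N.
by move/(summable_natP b0); rewrite boo ltxx.
Qed.

Lemma nneseries_shift (u : nat -> \bar R) : (forall t, 0 <= u t.+1)%E ->
  (\sum_(1 <= t <oo) u t = \sum_(0 <= t <oo) u t.+1)%E.
Proof.
move=> u0; apply/cvg_lim => //; rewrite -cvg_shiftS.
under eq_fun do rewrite big_add1 /=.
by apply: is_cvg_nneseries.
Qed.

(** Summing the recursion bounds (1 - rho) times the partial sums of v. *)
Lemma geometric_recursion_summable (v a : nat -> R) (rho c : R) :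
  0 <= rho < 1 -> 0 <= c -> (forall t, 0 <= v t) -> (forall t, 0 <= a t) ->
  (forall t, v t.+1 <= rho * v t + c * a t) -> summable_nat a -> summable_nat v.
Proof.
move=> /andP[rho0 rho1] c0 v0 a0 rec [B aB].
have sum_le N : (1 - rho) * \sum_(0 <= t < N) v t + v N <=
    v 0%N + c * \sum_(0 <= t < N) a t.
  elim: N => [|N IHN]; first by rewrite !big_geq // !mulr0 addr0 add0r.
  rewrite !big_nat_recr //= !mulrDr; have := rec N; lra.
exists ((v 0%N + c * B) / (1 - rho)) => N; rewrite ler_pdivlMr ?subr_gt0 //.
have := sum_le N; have := ler_wpM2l c0 (aB N); have := v0 N; lra.
Qed.

End NonnegSeries.

(** * Convergence of the mean of the states *)
Section Topology.
Context {R : realType} {d : nat}.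
Implicit Types (u v z : 'rV[R]_d).

Lemma nbhs_sqn z eps : 0 < eps -> nbhs z [set v | sqn (v - z) < eps].
Proof.
move=> e0; have d0 : 0 < (d.+1%:R : R) by rewrite ltr0n.
pose c := Num.min 1 (eps / d.+1%:R).
have c0 : 0 < c by rewrite lt_min ltr01 divr_gt0.
apply/(@nbhs_normP R 'rV[R]_d); exists c => //= v /=; rewrite /ball_ /= => zv.
have entry k : (v - z) 0 k * (v - z) 0 k <= c.
  have : `|(v - z) 0 k| <= `|z - v|.
    rewrite distrC [leRHS]mx_normrE.
    exact: (le_bigmax _ (fun ij => `|(v - z) ij.1 ij.2|) (0, k)).
  move=> /le_lt_trans/(_ zv) /ltW lt_c.
  rewrite -expr2 -real_normK ?num_real // expr2.
  apply: (le_trans (ler_pM _ _ lt_c lt_c)) => //.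
  by rewrite ler_piMr ?(ltW c0) // /c ge_min lexx.
apply: (@le_lt_trans _ _ (\sum_(k < d) c)); first by apply: ler_sum => k _.
rewrite sumr_const card_ord -mulr_natl.
have : c <= eps / d.+1%:R by rewrite /c ge_min lexx orbT.
rewrite ler_pdivlMr // mulrC; apply: lt_le_trans.
by rewrite ltr_pM2r // ltr_nat.
Qed.

Lemma cvg_sqn (u : nat -> 'rV[R]_d) z :
  (forall eps : R, 0 < eps ->
     exists N, forall t, (N <= t)%N -> sqn (u t - z) < eps) ->
  u t @[t --> \oo] --> z.
Proof.
move=> uz; apply/cvgrPdist_lt => eps e0.
have [N uN] := uz (eps ^+ 2) (exprn_gt0 _ e0).
exists N => // t /= Nt; have {}uN := uN t Nt.
rewrite distrC [ltLHS]mx_normrE; apply/bigmax_ltP; split=> //= -[i k] _.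
rewrite /= (ord1 i) -(ltr_pXn2r (n := 2)) ?nnegrE ?(ltW e0) //.
apply: le_lt_trans uN; rewrite real_normK ?num_real //; exact: entry_le_sqn.
Qed.

End Topology.

Section Descent.
Context {R : realType} {d : nat}.
Variables (F : 'rV[R]_d -> R) (m : nat -> 'rV[R]_d) (b e : nat -> R).
Hypothesis F_sub : forall y, subdiff F y !=set0.
Hypothesis b_ge0 : forall t, 0 <= b t.
Hypothesis e_ge0 : forall t, 0 <= e t.
Hypothesis b_div : forall B, exists N, B <= \sum_(0 <= t < N) b t.
Hypothesis e_sum : summable_nat e.
Hypothesis F_min : argmin F !=set0.
Hypothesis step : forall z, argmin F z -> forall t,
  sqn (m t.+1 - z) <= sqn (m t - z) - b t * (F (m t) - F z) + e t.

Let quasi_fejer z s t : argmin F z -> (s <= t)%N ->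
  sqn (m t - z) <= sqn (m s - z) + \sum_(s <= i < t) e i.
Proof.
move=> zF; elim: t => [|t IHt].
  by rewrite leqn0 => /eqP ->; rewrite big_geq // addr0.
rewrite leq_eqVlt => /predU1P[->|]; first by rewrite big_geq // addr0.
rewrite ltnS => st; rewrite big_nat_recr //=.
have := step zF t; have := IHt st.
have : 0 <= b t * (F (m t) - F z) by rewrite mulr_ge0 // subr_ge0 zF.
lra.
Qed.

(** Otherwise every step from N on would lower the squared distance to z by
    eps * b t up to summable errors, which sum b = oo forbids. *)
Let frequently_near_min z eps N : argmin F z -> 0 < eps ->
  exists2 t, (N <= t)%N & F (m t) < F z + eps.
Proof.
move=> zF eps0; apply: contrapT => nope.
have far t : (N <= t)%N -> eps <= F (m t) - F z.
  by move=> Nt; rewrite lerBrDl leNgt; apply/negP => h; apply: nope; exists t.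
have sum_le k : eps * \sum_(N <= i < N + k) b i <=
    sqn (m N - z) - sqn (m (N + k)%N - z) + \sum_(N <= i < N + k) e i.
  elim: k => [|k IHk]; first by rewrite addn0 !big_geq // mulr0 addr0 subrr.
  rewrite addnS !big_nat_recr ?leq_addr //= mulrDr.
  have := step zF (N + k)%N.
  have := ler_wpM2l (b_ge0 (N + k)) (far _ (leq_addr k N)); lra.
have [B eB] := e_sum.
have [M hM] := b_div (\sum_(0 <= i < N) b i + (sqn (m N - z) + B) / eps + 1).
have /andP[sN sB] : (\sum_(N <= i < N + M) e i <= B) &&
    (\sum_(0 <= t < M) b t <=
       \sum_(0 <= t < N) b t + \sum_(N <= i < N + M) b i).
  apply/andP; split.
    apply: le_trans (eB (N + M)%N).
    rewrite [leRHS](big_cat_nat _ (leq_addr M N)) //= lerDr; exact: sumr_ge0.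
  rewrite -(big_cat_nat _ (leq_addr M N)) //.
  rewrite [leRHS](big_cat_nat _ (leq_addl N M)) //= lerDl; exact: sumr_ge0.
have : (sqn (m N - z) + B) / eps + 1 <= \sum_(N <= i < N + M) b i by lra.
rewrite -(ler_pM2l eps0) mulrDr mulr1 mulrC divfK ?gt_eqF //.
have := sum_le M; have := sqn_ge0 (m (N + M)%N - z); lra.
Qed.

(** Near-minimizing iterates stay in a cube around a given minimizer, hence
    cluster at some z.  A subgradient of F at z shows that z is a minimizer too,
    and then the iterates cannot leave the neighbourhoods of z by more than the
    tail of the errors. *)
Lemma quasi_fejer_cvg : exists2 z, argmin F z &
  forall eps : R, 0 < eps ->
    exists N, forall t, (N <= t)%N -> sqn (m t - z) < eps.
Proof.
have [z0 z0F] := F_min.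
have /choice[tau tauP] k : exists t, (k <= t)%N /\ F (m t) < F z0 + k.+1%:R^-1.
  have k0 : 0 < (k.+1%:R^-1 : R) by rewrite invr_gt0 ltr0n.
  by have [t kt Ft] := frequently_near_min k z0F k0; exists t.
have [B eB] := e_sum.
(* With C at least 1, a squared distance of at most C bounds each coordinate of
   the difference by C. *)
pose C := sqn (m 0%N - z0) + B + 1.
have C1 : 1 <= C.
  rewrite lerDr addr_ge0 ?sqn_ge0 //.
  by have := eB 0%N; rewrite big_geq.
pose cube := [set v : 'rV[R]_d |
  forall k, `[z0 0 k - C, z0 0 k + C]%classic (v ord0 k)].
have cK : compact cube.
  apply: (@rV_compact R d (fun k => `[z0 0 k - C, z0 0 k + C]%classic)) => k.
  exact: segment_compact.
have [z [_ zcl]] : cube `&` cluster ((m \o tau) @ \oo) !=set0.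
  apply: cK; exists 0%N => // k _ i /=.
  have : sqn (m (tau k) - z0) <= C.
    apply: (le_trans (quasi_fejer z0F (leq0n _))).
    by rewrite /C; have := eB (tau k); lra.
  move=> /(le_trans (entry_le_sqn _ i)); rewrite !mxE => le_C.
  have : `|m (tau k) 0 i - z0 0 i| <= C.
    rewrite -(ler_pXn2r (n := 2)) ?nnegrE //; last lra.
    rewrite real_normK ?num_real //; apply: (le_trans le_C).
    by rewrite expr2 ler_peMr //; lra.
  by rewrite in_itv /= ler_norml; lra.
have freq N (eps : R) : 0 < eps ->
    exists2 k, (N <= k)%N & sqn (m (tau k) - z) < eps.
  move=> eps0.
  have [|_ [[k Nk <-] /= ?]] :=
    zcl [set m (tau k) | k in [set k | (N <= k)%N]] _ _ (nbhs_sqn z eps0).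
    by exists N => // k Nk; exists k.
  by exists k.
have zF : argmin F z.
  suff le0 : F z <= F z0 by move=> v; apply: (le_trans le0); exact: z0F.
  suff leD (eps : R) : 0 < eps -> F z <= F z0 + eps by apply/ler_addgt0Pr.
  move=> eps0; have [h hP] := F_sub z.
  (* Young's inequality with weight eta bounds the linear term by
     (eta |h|^2 + |u|^2 / eta) / 2, and eta is chosen so that eta |h|^2 is at
     most eps / 2. *)
  pose eta : R := eps / 2 / (sqn h + 1).
  have h1 : 0 < sqn h + 1 by have := sqn_ge0 h; lra.
  have eta0 : 0 < eta by rewrite divr_gt0 // divr_gt0.
  have [M hM] : exists M, forall k, (M <= k)%N -> (k.+1%:R^-1 : R) < eps / 2.
    have e20 : 0 < (eps / 2) by rewrite divr_gt0.
    exists (Num.truncn (eps / 2)^-1) => k kM.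
    rewrite -[ltRHS]invrK ltf_pV2 ?posrE ?invr_gt0 ?ltr0n //.
    apply: (lt_le_trans (truncnS_gt _)); by rewrite ler_nat ltnS.
  have eps2 : 0 < eta * (eps / 2) by rewrite mulr_gt0 // divr_gt0.
  have [k Mk hk] := freq M _ eps2.
  have := hP (m (tau k)); have := (tauP k).2; have := hM k Mk.
  have := young (- h) (m (tau k) - z) eta0; rewrite dotvNl sqnN.
  have e1 : eta * (sqn h + 1) = eps / 2 by rewrite divfK // gt_eqF.
  have e2 : eta^-1 * sqn (m (tau k) - z) < eps / 2.
    by rewrite -(ltr_pM2l eta0) mulVKf // gt_eqF.
  by move: e1 e2; move: (eta^-1 * _) (k.+1%:R^-1) => q r; lra.
exists z => // eps eps0; have eps2 : 0 < eps / 2 by rewrite divr_gt0.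
have [N tail] := summable_tail e_ge0 e_sum eps2.
have [k Nk near] := freq N _ eps2.
exists (tau k) => t tt.
apply: (le_lt_trans (quasi_fejer zF tt)).
have := tail _ t (leq_trans Nk (tauP k).1) tt; lra.
Qed.

End Descent.

Section OneStep.
Context {R : realType} {n d : nat}.
Hypothesis n_gt0 : (0 < n)%N.
Variables (f : 'I_n -> 'rV[R]_d -> R) (L2 : R).
Hypothesis f_sub : forall i w, subdiff (f i) w !=set0.
Hypothesis f_lip : forall i w g, subdiff (f i) w g -> sqn g <= L2.
Local Notation F := (fun v => \sum_(i < n) f i v).

(** The subgradient g_i at w_i gives f_i z >= f_i w_i + g_i.(z - w_i), and a
    subgradient h_i of f_i at the mean m gives f_i w_i >= f_i m + h_i.(w_i - m).
    Two terms with the factor w_i - m remain.  By Young's inequality each one,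
    multiplied by 2 a, is at most |w_i - m|^2 + a^2 L2.  The sum over i of
    |w_i - m|^2 is the disagreement after the round, hence at most that of X. *)
Lemma subgradient_step (a : R) (X W G : 'M[R]_(n, d)) s z :
  0 < a -> mixing s X W ->
  (forall i, subdiff (f i) (row i W) (row i G)) ->
  sqn (xbar (W - a *: G) - z) <= sqn (xbar X - z)
    - (2 * a / n%:R) * (F (xbar X) - F z)
    + (3 * L2 * a ^+ 2 + 2 / n%:R * disagreement X).
Proof.
move=> a0 sW GW; have nR : 0 < (n%:R : R) by rewrite ltr0n.
rewrite -scaleNr xbarD xbarZ (mixing_xbar sW) scaleNr; set m := xbar X.
have key i : - (2 * a * dotv (row i G) (m - z)) <=
    - (2 * a * (f i m - f i z)) + (2 * a ^+ 2 * L2 + 2 * sqn (row i W - m)).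
  have [h hP] := f_sub i m.
  have := GW i z; have := hP (row i W).
  have := f_lip hP; have := f_lip (GW i).
  have := young (row i W - m) (a *: row i G) ltr01.
  have := young (m - row i W) (a *: h) ltr01.
  have -> : dotv (m - row i W) (a *: h) = - (a * dotv h (row i W - m)).
    by rewrite dotvZr dotvC -opprB dotvNr mulrN.
  have -> : dotv (row i W - m) (a *: row i G) =
      a * dotv (row i G) (row i W - m).
    by rewrite dotvZr dotvC.
  have -> : dotv (row i G) (z - row i W) = - dotv (row i G) (row i W - m)
      - dotv (row i G) (m - z).
    by rewrite -opprD -dotvDr addrA subrK -opprB dotvNr.
  rewrite invr1 !mul1r !sqnZ (sqn_subC m) => h1 h2 h3 h4 h5 h6.
  have a2 : 0 <= a ^+ 2 by rewrite sqr_ge0.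
  have := ler_wpM2l a2 h3; have := ler_wpM2l a2 h4.
  have := ler_wpM2l (ltW a0) h5; have := ler_wpM2l (ltW a0) h6.
  lra.
have hsum : - (2 * a * (n%:R * dotv (xbar G) (m - z))) <=
    - (2 * a * (F m - F z)) +
    (n%:R * (2 * a ^+ 2 * L2) + 2 * \sum_i sqn (row i W - m)).
  rewrite -dotvZl -sum_row // dotv_suml -sumrB !mulr_sumr -!sumrN.
  have -> : n%:R * (2 * a ^+ 2 * L2) = \sum_(i < n) 2 * a ^+ 2 * L2.
    by rewrite sumr_const card_ord [LHS]mulr_natl.
  rewrite -!big_split /=.
  by apply: ler_sum => i _; exact: key.
have hW : \sum_i sqn (row i W - m) <= disagreement X.
  rewrite /m -(mixing_xbar sW); exact: mixing_disagreement_le sW.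
have hG : n%:R * sqn (xbar G) <= n%:R * L2.
  apply: (le_trans (sqn_xbar_le n_gt0 G)).
  apply: (le_trans (ler_sum _ (fun i _ => f_lip (GW i)))).
  by rewrite sumr_const card_ord -[leLHS]mulr_natl.
have -> : sqn (m - a *: xbar G - z) =
    sqn (m - z) - 2 * a * dotv (xbar G) (m - z) + a ^+ 2 * sqn (xbar G).
  rewrite addrAC (sqnB (m - z)) sqnZ dotvZr (dotvC (m - z)); ring.
have := ler_wpM2l (sqr_ge0 a) hG.
move=> hG2; rewrite -(ler_pM2l nR).
have ne : (n%:R : R) != 0 by rewrite gt_eqF.
have -> : n%:R * (sqn (m - z) - 2 * a / n%:R * (F m - F z)
   + (3 * L2 * a ^+ 2 + 2 / n%:R * disagreement X))
  = n%:R * sqn (m - z) - 2 * a * (F m - F z)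
    + (n%:R * 3 * L2 * a ^+ 2 + 2 * disagreement X).
  by field.
lra.
Qed.
End OneStep.

(** * Events selected with conditional probability bounded below *)
Section MeasureComparison.
Local Open Scope ereal_scope.
Context d (T : measurableType d) (R : realType).
Import HBNNSimple.

Lemma le_integral_mrestr (mu : {measure set T -> \bar R}) (S : set T)
    (mS : measurable S) (f : T -> \bar R) : (forall x, 0 <= f x) ->
  \int[mrestr mu mS]_x f x <= \int[mu]_(x in S) f x.
Proof.
move=> f0; rewrite ge0_integralTE // ge0_integralE //.
apply: ge_ereal_sup => _ [h hf <-].
have hE x : proj_nnsfun h mS x = if x \in S then h x else 0%R.
  by rewrite -mrestrict.
apply: ereal_sup_ubound; exists (proj_nnsfun h mS).
  move=> x; rewrite hE /patch; case: ifP => // _; exact: hf.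
rewrite !sintegralET; apply: eq_fsbigr => x _.
have [->|x0] := eqVneq x 0%R; first by rewrite !mul0e.
congr (_ * mu _); apply/seteqP; split=> y;
  rewrite /preimage /mkset hE /=; case: ifPn => yS.
- by move=> <-; split=> //; exact: set_mem.
- by move=> /esym/eqP; rewrite (negbTE x0).
- by case.
- by case=> _ /mem_set; rewrite (negbTE yS).
Qed.

(** The hypothesis says that S has conditional probability at least p given g.
    Transporting to the real line, it compares the law of g, scaled by p, with
    the law of g on S, and integrals are monotone in the measure. *)
Lemma integral_thinning (mu : {measure set T -> \bar R}) (S : set T) (p : R)
    (g : T -> R) : measurable S -> (0 <= p)%R ->
  measurable_fun setT g -> (forall x, 0 <= g x)%R ->
  (forall B, measurable B -> p%:E * mu (g @^-1` B) <= mu (g @^-1` B `&` S)) ->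
  p%:E * \int[mu]_x (g x)%:E <= \int[mu]_(x in S) (g x)%:E.
Proof.
move=> mS p0 mg g0 thin.
pose q : {nonneg R} := NngNum p0.
(* The absolute value agrees with the identity on the range of g and makes the
   integrand nonnegative on the whole line. *)
pose absE : R -> \bar R := fun y => (`|y|%R)%:E.
have mE : measurable_fun setT absE.
  by apply/measurable_EFinP; exact: normr_measurable.
have pushE (m : {measure set T -> \bar R}) :
    \int[m]_x (g x)%:E = \int[pushforward m g]_y absE y.
  rewrite (@ge0_integral_pushforward _ _ _ _ _ g mg m setT absE) //.
    rewrite preimage_setT; apply: eq_integral => x _.
    by rewrite /absE /= ger0_norm.
  by move=> y _; rewrite /absE lee_fin.
apply: (@le_trans _ _ (\int[mrestr mu mS]_x (g x)%:E)); last first.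
  by apply: le_integral_mrestr => x; rewrite lee_fin.
have mgE : measurable_fun setT (fun x => (g x)%:E) by exact/measurable_EFinP.
rewrite -[p]/(q%:num) -(ge0_integral_mscale _ measurableT q mgE) //; last first.
  by move=> x _; rewrite lee_fin.
rewrite !pushE.
by apply: ge0_le_measure_integral => // y; rewrite /absE lee_fin.
Qed.

End MeasureComparison.

Section RandomChoice.
Local Open Scope ereal_scope.
Context {R : realType} {disp : measure_display} {T : measurableType disp}.
Variable mu : {measure set T -> \bar R}.

(** The integral of a nonnegative function is the supremum of the integrals of
    the smaller simple functions; this order argument covers integrands that
    are only known pointwise, such as products of acknowledgement
    probabilities. *)
Lemma ge0_le_integral_pointwise (D : set T) (f1 f2 : T -> \bar R) :
  (forall x, D x -> 0 <= f1 x) -> (forall x, D x -> f1 x <= f2 x) ->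
  \int[mu]_(x in D) f1 x <= \int[mu]_(x in D) f2 x.
Proof.
move=> f10 f12; have f20 x : D x -> 0 <= f2 x.
  by move=> Dx; exact: le_trans (f10 x Dx) (f12 x Dx).
rewrite !ge0_integralE //; apply: ge_ereal_sup => _ [h hf <-].
apply: ereal_sup_ubound; exists h => // x; apply: (le_trans (hf x)).
by rewrite /patch; case: ifPn => // /set_mem; exact: f12.
Qed.

Section Selection.
Variables (C : finType) (c : T -> C) (wanted : C -> set T).

Lemma selectedE (H : set T) : H `&` [set w | wanted (c w) w] =
  \bigcup_(u in [set: C]) (H `&` wanted u `&` c @^-1` [set u]).
Proof.
apply/seteqP; split=> [w [Hw ww]|w [u _ [[Hw ww] /= cu]]].
  by exists (c w).
by split=> //=; rewrite cu.
Qed.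

Hypothesis mc : forall u, measurable (c @^-1` [set u]).
Hypothesis mwanted : forall u, measurable (wanted u).

Lemma measurable_selected : measurable [set w | wanted (c w) w].
Proof.
rewrite -[X in measurable X]setTI selectedE.
apply: fin_bigcup_measurable => [|u _]; first exact: finite_finset.
by apply: measurableI => //; exact: measurableI.
Qed.

(** A random choice c makes a wanted choice on a part of H of measure at least
    p mu(H), provided that each value is chosen with conditional probability at
    least p where it is wanted and that some value is wanted everywhere.  The
    events c = u being disjoint, the measures of their parts add up, while the
    sets wanted u may overlap. *)
Lemma selected_ge (p : R) (H : set T) :
  (0 <= p)%R -> measurable H -> (forall w, exists u, wanted u w) ->
  (forall u, p%:E * mu (H `&` wanted u) <=
             mu (H `&` wanted u `&` c @^-1` [set u])) ->
  p%:E * mu H <= mu (H `&` [set w | wanted (c w) w]).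
Proof.
move=> p0 mH cov le_p; rewrite selectedE.
have finC : finite_set [set: C] by exact: finite_finset.
rewrite measure_fin_bigcup //; last 2 first.
- by move=> u v _ _ [w [[_ /= <-] [_ /= <-]]].
- by move=> u _; apply: measurableI => //; exact: measurableI.
apply: (@le_trans _ _ (p%:E * \sum_(u \in [set: C]) mu (H `&` wanted u))).
  apply: lee_wpmul2l; first by rewrite lee_fin.
  apply: content_sub_fsum => //; first by move=> u _; exact: measurableI.
  by move=> w Hw; have [u wu] := cov w; exists u.
rewrite ge0_mule_fsumr; last by move=> u; exact: measure_ge0.
by apply: lee_fsum => // u _; exact: le_p.
Qed.

End Selection.

End RandomChoice.

(** * Measurability of comparisons of distances *)
Section FiniteMeasurability.
Context {disp : measure_display} {T : measurableType disp}.

(** A condition on finitely many tests partitions the space into finitely many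
    pieces, one for each vector of outcomes. *)
Lemma measurable_finite_test (I : finType) (b : I -> T -> bool)
    (Q : {ffun I -> bool} -> Prop) :
  (forall i, measurable [set w | b i w]) ->
  measurable [set w | Q [ffun i => b i w]].
Proof.
move=> mb.
have -> : [set w | Q [ffun i => b i w]] =
    \bigcup_(c in [set c | Q c]) \bigcap_(i in [set: I]) [set w | b i w = c i].
  apply/seteqP; split => [w Qw|w [c Qc bc]] /=.
    by exists [ffun i => b i w] => // i _ /=; rewrite ffunE.
  by rewrite (_ : [ffun i => b i w] = c) //; apply/ffunP => i; rewrite ffunE bc.
apply: fin_bigcup_measurable => // c _; apply: fin_bigcap_measurable => // i _.
case: (c i); first exact: mb.
rewrite (_ : [set w | _] = ~` [set w | b i w]); first exact: measurableC.
by apply/seteqP; split=> w /=; [move=> -> | move/negP/negbTE].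
Qed.

End FiniteMeasurability.

Section StateMeasurability.
Context {R : realType} {n d : nat} {disp : measure_display}
  {T : measurableType disp}.
Variable X : T -> 'M[R]_(n, d).
Hypothesis mX : forall i j, measurable_fun setT (fun w => X w i j).

Lemma measurable_disagreement :
  measurable_fun setT (fun w => disagreement (X w)).
Proof.
rewrite (_ : (fun w => _) = fun w => \sum_(i <- index_enum 'I_n)
    \sum_(k <- index_enum 'I_d)
      (X w i k - n%:R^-1 * \sum_(j <- index_enum 'I_n) X w j k) ^+ 2).
  apply: measurable_sum => i; apply: measurable_sum => k.
  apply: measurable_funX; apply: measurable_funB => //.
  apply: measurable_funM => //; exact: measurable_sum.
apply/funext => w; apply: eq_bigr => i _; apply: eq_bigr => k _.
rewrite -expr2 !mxE summxE; congr ((_ - _ * _) ^+ _).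
by apply: eq_bigr => j _; rewrite mxE.
Qed.

Lemma measurable_order_invariant (Q : 'M[R]_(n, d) -> Prop) :
  order_invariant Q -> measurable [set w | Q (X w)].
Proof.
move=> invQ.
pose cmp (Y : 'M[R]_(n, d)) (q : 'I_n * 'I_n * 'I_n * 'I_n) :=
  sqn (row q.1.1.1 Y - row q.1.1.2 Y) <= sqn (row q.1.2 Y - row q.2 Y) :> R.
(* Since Q is order invariant, it is decided by the table of comparisons: it
   holds at a state exactly when some state with the same table satisfies it. *)
pose realized (c : {ffun _ -> bool}) := exists2 Y, Q Y & c = finfun (cmp Y).
have -> : [set w | Q (X w)] = [set w | realized [ffun q => cmp (X w) q]].
  apply/seteqP; split=> w /= => [QX|[Y QY XY]]; first by exists (X w).
  apply: invQ QY => i j k l; rewrite !sdist_le.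
  have := congr1 (fun c : {ffun _ -> _} => c (i, j, k, l)) XY.
  by rewrite !ffunE.
apply: (measurable_finite_test (b := fun q w => cmp (X w) q) realized) => q.
have mdist i j : measurable_fun setT (fun w => sqn (row i (X w) - row j (X w))).
  rewrite (_ : (fun w => _) = fun w =>
      \sum_(k <- index_enum 'I_d) (X w i k - X w j k) ^+ 2).
    apply: measurable_sum => k; apply: measurable_funX.
    exact: measurable_funB.
  by apply/funext => w; apply: eq_bigr => k _; rewrite !mxE -expr2.
rewrite -[X in measurable X]setTI; exact: measurable_fun_le.
Qed.

End StateMeasurability.

Section Past.
Context {R : realType} {n d : nat} {disp : measure_display}
  {T : measurableType disp}.
Variables (X : nat -> T -> 'M[R]_(n, d)).
Variables (C : Type) (c : nat -> T -> C) (t : nat).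

Lemma past_setI H1 H2 :
  past X c t H1 -> past X c t H2 -> past X c t (H1 `&` H2).
Proof.
rewrite /past; set GG := (X in <<s X >>).
exact: (@measurableI _ (g_sigma_algebraType GG)).
Qed.

(** On the measurable space generated by the past, the state at time t is
    measurable by definition; the two lemmas transfer the measurability results
    for functions of a random state to that space. *)
Lemma past_disagreement B : measurable B ->
  past X c t ((fun w => disagreement (X t w)) @^-1` B).
Proof.
move=> mB; rewrite /past; set GG := (X in <<s X >>).
have mX i j : measurable_fun setT (fun w : g_sigma_algebraType GG => X t w i j).
  move=> _ D mD; rewrite setTI; apply: sub_sigma_algebra.
  by left; exists t, i, j, D.
have := @measurable_disagreement _ _ _ _ (g_sigma_algebraType GG) (X t) mX.
by move=> /(_ measurableT B mB); rewrite setTI.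
Qed.

Lemma past_order_invariant (Q : 'M[R]_(n, d) -> Prop) :
  order_invariant Q -> past X c t [set w | Q (X t w)].
Proof.
move=> invQ; rewrite /past; set GG := (X in <<s X >>).
have mX i j : measurable_fun setT (fun w : g_sigma_algebraType GG => X t w i j).
  move=> _ D mD; rewrite setTI; apply: sub_sigma_algebra.
  by left; exists t, i, j, D.
exact: (@measurable_order_invariant _ _ _ _ (g_sigma_algebraType GG) (X t) mX).
Qed.

End Past.

(** * The three schemes *)
Section SchemesContract.
Local Open Scope ereal_scope.
Context {R : realType} {n d : nat}.
Hypothesis hn : (2 <= n)%N.
Variable E : rel 'I_n.
Hypotheses (hsym : symmetric E) (hirr : irreflexive E)
  (hconn : forall i j, connect E i j).
Context {disp : measure_display} {T : measurableType disp}.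
Variable P : probability T R.
Variables (X : nat -> T -> 'M[R]_(n, d)) (A : nat -> T -> 'M[R]_n).
Hypothesis mX : forall t i j, measurable_fun setT (fun w => X t w i j).

(** In round t the event S, on which an averaged pair is a longest edge, has
    conditional probability at least p given the disagreement of X t. *)
Definition contracting (p : R) : Prop := forall t, exists S : set T,
  [/\ measurable S,
      forall B, measurable B ->
        p%:E * P ((fun w => disagreement (X t w)) @^-1` B) <=
        P ((fun w => disagreement (X t w)) @^-1` B `&` S) &
      forall w, exists s, mixing s (X t w) (A t w *m X t w) /\
        (S w -> exists i, longest_edge E (X t w) i (s i))].

Let has_edge : exists i j, E i j. Proof. exact: connected_edge. Qed.

Let m_disagreement t B : measurable B ->
  measurable ((fun w => disagreement (X t w)) @^-1` B).
Proof.
move=> mB; have := measurable_disagreement (mX t) measurableT mB.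
by rewrite setTI.
Qed.

Lemma max_gossip_contracting : max_gossip E X A -> contracting 1.
Proof.
move=> hA t; exists setT; split=> // [B _|w]; first by rewrite mul1e setIT.
have [i [j [[ij Eij maxE _] ->]]] := hA t w.
exists (tperm i j); split; first exact: avg_mx_mixing.
move=> _; exists i; rewrite tpermL; split=> // k l Ekl.
case: (ltngtP k l) => [kl|lk|/val_inj kl]; first exact: maxE.
- by rewrite sdistC maxE // hsym.
- by rewrite kl hirr in Ekl.
Qed.

(** Once an endpoint of a longest edge is drawn, its farthest neighbour is at
    the other end of a longest edge.  An endpoint is determined by the past and
    drawn with probability 1 / n. *)
Lemma local_max_gossip_contracting : local_max_gossip P E X A ->
  contracting n%:R^-1.
Proof.
move=> [s [ms Ps indep hA]] t.
pose wanted (u : 'I_n) := [set w | exists j, longest_edge E (X t w) u j].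
have inv u : order_invariant
    (fun Y : 'M[R]_(n, d) => exists j, longest_edge E Y u j).
  by move=> Y Z YZ [j Yj]; exists j; exact: longest_edge_order_invariant YZ Yj.
have mw u : measurable (wanted u) by exact: measurable_order_invariant (inv u).
exists [set w | wanted (s t w) w]; split.
- exact: measurable_selected.
- move=> B mB; apply: selected_ge => //; first exact: m_disagreement.
    move=> w; have [i [j ij]] := longest_edge_exists (X t w) has_edge.
    by exists i, j.
  move=> u; rewrite [leRHS]indep; first by rewrite Ps muleC.
  apply: past_setI; first exact: past_disagreement.
  exact: (@past_order_invariant _ _ _ _ _ X _ s t _ (inv u)).
- move=> w; have [r [[Esr maxr _] ->]] := hA t w.
  exists (tperm (s t w) r); split; first exact: avg_mx_mixing.
  move=> [j [Esj maxE]]; exists (s t w); rewrite tpermL; split=> // k l /maxE.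
  by move=> /le_trans; apply; exact: maxr.
Qed.

(** For every state there is an acknowledgement pattern in which the endpoints
    of a longest edge acknowledge each other and every agent makes a choice of
    conditional probability at least 1 / n; by independence it occurs with
    conditional probability at least 1 / n^n. *)
Lemma load_balancing_contracting : load_balancing P E X A ->
  contracting (n%:R^-1 ^+ n).
Proof.
move=> [ack [mack Pack hA]] t.
pose good (a : {ffun 'I_n -> option 'I_n}) (Y : 'M[R]_(n, d)) :=
  (forall k, n%:R^-1 <= ack_prob E Y k (a k))%R /\
  exists i j, [/\ longest_edge E Y i j, a i = Some j & a j = Some i].
have inv a : order_invariant (good a).
  move=> Y Z YZ [ge_a [i [j [Yij ai aj]]]]; split.
    by move=> k; rewrite -(ack_prob_same_order E k (a k) YZ).
  by exists i, j; split=> //; exact: longest_edge_order_invariant YZ Yij.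
pose wanted a := [set w | good a (X t w)].
have mw a : measurable (wanted a) by exact: measurable_order_invariant (inv a).
exists [set w | wanted (ack t w) w]; split.
- exact: measurable_selected.
- move=> B mB; apply: selected_ge => //.
  + exact: m_disagreement.
  + move=> w; have [i [j ij]] := longest_edge_exists (X t w) has_edge.
    have ne_ij : i != j by apply: contraTneq ij.1 => ->; rewrite hirr.
    exists [ffun k => if k == i then Some j else if k == j then Some i
      else [pick r in requests E (X t w) k]]; split; last first.
      by exists i, j; rewrite !ffunE !eqxx eq_sym (negbTE ne_ij).
    move=> k; rewrite ffunE; case: eqP => [->|_].
      exact/ack_prob_some_ge/longest_edge_requests.
    case: eqP => [->|_].
      exact/ack_prob_some_ge/longest_edge_requests/longest_edgeC.
    case: pickP => [r|req0]; first exact: ack_prob_some_ge.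
    rewrite /ack_prob eq_card0 //= invf_le1 ?ler1n ?ltr0n; exact: leq_trans hn.
  + move=> a; rewrite [leRHS]Pack; last first.
      apply: past_setI; first exact: past_disagreement.
      exact: (@past_order_invariant _ _ _ _ _ X _ ack t _ (inv a)).
    rewrite -(integral_cst P); last first.
      by apply: measurableI => //; exact: m_disagreement.
    apply: ge0_le_integral_pointwise => w; first by rewrite lee_fin exprn_ge0.
    move=> [_ [ge_a _]]; rewrite lee_fin -[leLHS]/(_ ^+ n)%R.
    rewrite -[X in (_ ^+ X)%R](card_ord n) -prodr_const.
    by apply: ler_prod => k _; rewrite invr_ge0 ler0n ge_a.
- move=> w; exists (partner (ack t w)); rewrite hA; split.
    exact: lb_update_mixing.
  move=> [_ [i [j [ij ai aj]]]]; exists i.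
  by rewrite /partner ai aj eqxx.
Qed.

Lemma scheme_contracting :
  [\/ local_max_gossip P E X A, max_gossip E X A | load_balancing P E X A] ->
  exists p : R, [/\ (0 < p)%R, (p <= 1)%R & contracting p].
Proof.
have n0 : (0 < (n%:R : R))%R by rewrite ltr0n; exact: leq_trans hn.
have n1 : ((n%:R : R)^-1 <= 1)%R.
  by rewrite invf_le1 // ler1n; exact: leq_trans hn.
case=> h.
- exists (n%:R^-1)%R; split; rewrite ?invr_gt0 //.
  exact: local_max_gossip_contracting.
- by exists 1%R; split=> //; exact: max_gossip_contracting.
- exists (n%:R^-1 ^+ n)%R; split; last exact: load_balancing_contracting.
    by rewrite exprn_gt0 // invr_gt0.
  by rewrite exprn_ile1 // invr_ge0 ltW.
Qed.

End SchemesContract.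

(** * Almost sure summability of the disagreement *)
Section ExpectedDisagreement.
Local Open Scope ereal_scope.
Context {R : realType} {disp : measure_display} {T : measurableType disp}.
Variable P : probability T R.

(** Taking expectations turns the hypothesis into a recursion for E (V t) with
    factor (1 + x) (1 - x) = 1 - x^2, where x = delta p.  Hence the sum of the
    V t has a finite expectation, and is finite almost surely. *)
Lemma ae_summable (V : nat -> T -> R) (a : nat -> R) (v0 p delta c : R) :
  (forall t, measurable_fun setT (V t)) -> (forall t w, 0 <= V t w)%R ->
  (forall w, V 0%N w = v0) -> (forall t, 0 <= a t)%R -> summable_nat a ->
  (0 < p <= 1)%R -> (0 < delta < 1)%R -> (0 <= c)%R ->
  (forall t, exists S : set T, [/\ measurable S,
    forall B, measurable B -> p%:E * P (V t @^-1` B) <= P (V t @^-1` B `&` S) &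
    forall w, (V t.+1 w <=
      (1 + delta * p) *
        (V t w - (if `[< S w >] then delta * V t w else 0)) + c * a t)%R]) ->
  {ae P, forall w, summable_nat (fun t => V t w)}.
Proof.
move=> mV V_ge0 V0 a0 a_sum /andP[p0 p1] /andP[d0 d1] c0 step.
pose EV t := \int[P]_w (V t w)%:E.
have mEV t : measurable_fun setT (fun w => (V t w)%:E).
  by apply/measurable_EFinP.
have EV_ge0 t : 0 <= EV t by apply: integral_ge0 => w _; rewrite lee_fin.
set x := (delta * p)%R in step *.
have x0 : (0 < x)%R by rewrite mulr_gt0.
have x1 : (x < 1)%R by apply: le_lt_trans d1; rewrite ler_piMr // ltW.
have rec t : EV t.+1 + ((1 + x) * delta * p)%:E * EV t <=
    (1 + x)%:E * EV t + (c * a t)%:E.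
  have [S [mS thin stepS]] := step t.
  pose U := (fun w => (V t w)%:E) \_ S.
  have U_ge0 w : 0 <= U w.
    by rewrite /U /patch; case: ifP => //; rewrite lee_fin.
  have mU : measurable_fun setT U.
    by apply/(measurable_restrictT _ mS).1; apply: measurable_funS (mEV t).
  have k0 : (0 <= (1 + x) * delta)%R by rewrite mulr_ge0 ?addr_ge0 ?ltW.
  apply: (@le_trans _ _
      (EV t.+1 + ((1 + x) * delta)%:E * \int[P]_(w in S) (V t w)%:E)).
    rewrite leeD2l // EFinM -muleA.
    apply: lee_wpmul2l; first by rewrite lee_fin.
    exact: integral_thinning (ltW p0) (mV t) (V_ge0 t) thin.
  rewrite integral_mkcond -/U -ge0_integralZl_EFin //.
  rewrite -ge0_integralD //; last 3 first.
  - by move=> w _; rewrite lee_fin.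
  - by move=> w _; rewrite mule_ge0 // lee_fin.
  - exact: measurable_funeM.
  have -> : (c * a t)%:E = \int[P]_w (cst (c * a t)%:E) w.
    by rewrite integral_cst // [X in _ * X]probability_setT mule1.
  rewrite -ge0_integralZl_EFin //; last 2 first.
  - by move=> w _; rewrite lee_fin.
  - by rewrite addr_ge0 // ltW.
  rewrite -ge0_integralD //; last 3 first.
  - by move=> w _; rewrite mule_ge0 // lee_fin // addr_ge0 // ltW.
  - exact: measurable_funeM.
  - by move=> w _; rewrite lee_fin mulr_ge0.
  apply: ge0_le_integral_pointwise => w _.
    by rewrite adde_ge0 ?mule_ge0 ?lee_fin.
  rewrite /U /patch; have := stepS w; have [Sw|Sw] := asboolP (S w).
    rewrite mem_set // -!EFinM -!EFinD lee_fin; lra.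
  rewrite memNset // mule0 adde0 -EFinM -EFinD lee_fin; lra.
have fin t : EV t \is a fin_num.
  elim: t => [|t IHt].
    rewrite /EV (eq_integral (cst v0%:E)) => [|w _]; last by rewrite V0.
    by rewrite integral_cst // [X in _ * X]probability_setT mule1.
  rewrite ge0_fin_numE //.
  apply: (@le_lt_trans _ _ ((1 + x)%:E * EV t + (c * a t)%:E)).
    apply: le_trans (rec t); rewrite leeDl // mule_ge0 // lee_fin.
    by rewrite !mulr_ge0 ?addr_ge0 ?ltW.
  by rewrite -(fineK IHt) -EFinM -EFinD ltry.
pose v t := fine (EV t).
have vE t : EV t = (v t)%:E by rewrite fineK.
have v_ge0 t : (0 <= v t)%R by rewrite fine_ge0.
have v_sum : summable_nat v.
  apply: (@geometric_recursion_summable _ v a (1 - x ^+ 2) c) => // [|t].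
    have : (x ^+ 2 <= 1)%R by rewrite exprn_ile1 // ltW.
    have : (0 < x ^+ 2)%R by rewrite exprn_gt0.
    lra.
  have := rec t; rewrite !vE -!EFinM -!EFinD lee_fin /x; lra.
have sumE : \int[P]_w (\sum_(0 <= t <oo) (V t w)%:E) < +oo.
  rewrite integral_nneseries //; last by move=> t w _; rewrite lee_fin.
  rewrite (eq_eseriesr (g := fun t => (v t)%:E)); last by move=> t _; exact: vE.
  exact/(summable_natP v_ge0).
have mF : measurable_fun setT (fun w => \sum_(0 <= t <oo) (V t w)%:E).
  apply: ge0_emeasurable_sum => //; by move=> t w _ _; rewrite lee_fin.
have F_ge0 w : 0 <= \sum_(0 <= t <oo) (V t w)%:E.
  by apply: nneseries_ge0 => t _ _; rewrite lee_fin.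
have intF : P.-integrable setT (fun w => \sum_(0 <= t <oo) (V t w)%:E).
  apply/integrableP; split=> //.
  by under eq_integral => w _ do rewrite gee0_abs //.
have := integrable_ae measurableT intF; apply: filterS => w /(_ I) Ffin.
by apply/(summable_natP (V_ge0 ^~ w)); rewrite -ge0_fin_numE.
Qed.

End ExpectedDisagreement.

(** * Convergence of the agents *)
Theorem corollary1 (R : realType) (n d : nat) (hn : (2 <= n)%N)
  (f : 'I_n -> 'rV[R]_d -> R)
  (hconvex : forall i, convex_function setT (f i))
  (hmin : argmin (fun w => \sum_(i < n) f i w) !=set0)
  (hlip : forall i, exists L : R,
     forall w g, subdiff (f i) w g -> enorm g <= L)
  (E : rel 'I_n) (hsym : symmetric E) (hirr : irreflexive E)
  (hconn : forall i j, connect E i j)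
  (alpha : nat -> R)
  (halpha_pos : forall t, (1 <= t)%N -> 0 < alpha t)
  (halpha_noninc : forall s t, (1 <= s)%N -> (s <= t)%N -> alpha t <= alpha s)
  (halpha_sum : (\sum_(1 <= t <oo) (alpha t)%:E = +oo)%E)
  (halpha_sum2 : (\sum_(1 <= t <oo) (alpha t ^+ 2)%:E < +oo)%E)
  (disp : measure_display) (T : measurableType disp) (P : probability T R)
  (X W G : nat -> T -> 'M[R]_(n, d)) (A : nat -> T -> 'M[R]_n)
  (x0 : 'M[R]_(n, d)) (hinit : forall w, X 0%N w = x0)
  (hmeas : forall t i j,
     measurable_fun setT ((fun w => X t w i j) : T -> measurableTypeR R))
  (hW : forall t w, W t.+1 w = A t w *m X t w)
  (hX : forall t w, X t.+1 w = W t.+1 w - alpha t.+1 *: G t.+1 w)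
  (hG : forall t w i, subdiff (f i) (row i (W t.+1 w)) (row i (G t.+1 w)))
  (hscheme : [\/ local_max_gossip P E X A, max_gossip E X A
               | load_balancing P E X A]) :
  {ae P, forall w, exists2 wstar : 'rV[R]_d,
     argmin (fun v => \sum_(i < n) f i v) wstar &
     forall i, row i (W t w) @[t --> \oo] --> wstar}.
Proof.
have n_gt0 : (0 < n)%N by exact: leq_trans hn.
have nR0 : 0 < (n%:R : R) by rewrite ltr0n.
have alpha_gt0 t : 0 < alpha t.+1 by exact: halpha_pos.
pose a t := alpha t.+1 ^+ 2.
have a_ge0 t : 0 <= a t by exact: sqr_ge0.
have a_sum : summable_nat a.
  by apply/(summable_natP a_ge0); move: halpha_sum2; rewrite nneseries_shift //.
have [L L_bound] := choice hlip.
pose L2 := \sum_i L i ^+ 2.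
have L2_ge0 : 0 <= L2 by apply: sumr_ge0 => i _; exact: sqr_ge0.
have f_lip i y g : subdiff (f i) y g -> sqn g <= L2.
  move=> /(L_bound i) g_le; rewrite -enorm_sqn /L2 (bigD1 i) //= ler_wpDr //.
    by apply: sumr_ge0 => j _; exact: sqr_ge0.
  by rewrite lerXn2r ?nnegrE ?sqrtr_ge0 // (le_trans _ g_le) ?sqrtr_ge0.
have f_sub i y : subdiff (f i) y !=set0 by exact: subdiff_nonempty.
have F_sub y : subdiff (fun v => \sum_i f i v) y !=set0.
  have [g gP] := choice (f_sub ^~ y); exists (\sum_i g i); exact: subdiff_sum.
have [p [p0 p1 contr]] := scheme_contracting hn hsym hirr hconn hmeas hscheme.
have [delta delta01 contracts] := mixing_contracts R d n_gt0 hconn.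
have [delta0 _] := andP delta01.
have mixed t w : exists s, mixing s (X t w) (W t.+1 w).
  by have [S [_ _ /(_ w) [s [sW _]]]] := contr t; exists s; rewrite hW.
have sum_G t w : \sum_i sqn (row i (G t.+1 w)) <= n%:R * L2.
  apply: le_trans (ler_sum _ (fun i _ => f_lip _ _ _ (hG t w i))) _.
  by rewrite sumr_const card_ord -[leLHS]mulr_natl.
have dp0 : 0 < delta * p by rewrite mulr_gt0.
(* With weight delta p in disagreement_step, c alpha(t+1)^2 bounds the effect of
   the subgradients on the disagreement. *)
pose c := (1 + (delta * p)^-1) * (n%:R * L2).
have c_ge0 : 0 <= c.
  by rewrite mulr_ge0 ?addr_ge0 ?invr_ge0 ?(ltW dp0) // mulr_ge0 // ltW.
have V_sum : {ae P, forall w, summable_nat (fun t => disagreement (X t w))}.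
  apply: (@ae_summable _ _ _ P _ a (disagreement x0) p delta c) => //.
  - move=> t; apply: measurable_disagreement => i j; exact: hmeas.
  - by move=> t w; exact: disagreement_ge0.
  - by move=> w; rewrite hinit.
  - by rewrite p0.
  move=> t; have [S [mS thin mixS]] := contr t; exists S; split=> // w.
  have [s [sW goodS]] := mixS w; rewrite -hW in sW.
  rewrite hX; apply: (le_trans (disagreement_step n_gt0 _ _ _ dp0)).
  apply: lerD.
    apply: ler_wpM2l; first by rewrite addr_ge0 // ltW.
    case: asboolP => [/goodS[i long_i]|_]; first exact: contracts sW long_i.
    by rewrite subr0; exact: mixing_disagreement_le sW.
  rewrite /c -!mulrA (mulrA n%:R) (mulrC _ (a t)).
  apply: ler_wpM2l; first by rewrite addr_ge0 // invr_ge0 ltW.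
  by rewrite mulrA -expr2 -/(a t) ler_wpM2l.
apply: filterS V_sum => w w_sum.
pose e t := 3 * L2 * a t + 2 / n%:R * disagreement (X t w).
have e_sum : summable_nat e.
  by apply: summable_natD => //; rewrite ?mulr_ge0 ?divr_ge0.
have e_ge0 t : 0 <= e t.
  apply: addr_ge0; apply: mulr_ge0 => //; first exact: mulr_ge0.
  exact: disagreement_ge0.
pose b t := 2 * alpha t.+1 / n%:R.
have b_ge0 t : 0 <= b t by rewrite divr_ge0 // mulr_ge0 // ltW.
have b_div B : exists N, B <= \sum_(0 <= t < N) b t.
  have alpha_oo : (\sum_(0 <= t <oo) (alpha t.+1)%:E = +oo)%E.
    move: halpha_sum; rewrite nneseries_shift // => t /=.
    by rewrite lee_fin ltW.
  have [N leN] := nneseries_pinfty_unbounded (fun t => ltW (alpha_gt0 t))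
    alpha_oo (B * (n%:R / 2)).
  exists N; rewrite -mulr_suml -mulr_sumr ler_pdivlMr //.
  by move: leN; lra.
have descent z : argmin (fun v => \sum_i f i v) z -> forall t,
    sqn (xbar (X t.+1 w) - z) <= sqn (xbar (X t w) - z)
      - b t * (\sum_i f i (xbar (X t w)) - \sum_i f i z) + e t.
  move=> _ t; have [s sW] := mixed t w; rewrite hX.
  by have := subgradient_step n_gt0 f_sub f_lip z (alpha_gt0 t) sW (hG t w).
have [z zF zlim] := quasi_fejer_cvg F_sub b_ge0 e_ge0 b_div e_sum hmin descent.
(* W 0 is unconstrained, so the limit is taken along W (t + 1). *)
exists z => // i; rewrite -cvg_shiftS; apply: cvg_sqn => eps eps0.
have eps4 : 0 < eps / 4 by rewrite divr_gt0.
have [N1 zN] := zlim _ eps4.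
have [N2 vN] := summable_cvg0 (fun t => disagreement_ge0 (X t w)) w_sum eps4.
exists (maxn N1 N2) => t; rewrite geq_max => /andP[N1t N2t].
have [s sW] := mixed t w.
rewrite -[row i _](subrK (xbar (X t w))) -addrA.
apply: (le_lt_trans (sqnD_le2 _ _)).
have := zN t N1t; have := vN t N2t.
have : sqn (row i (W t.+1 w) - xbar (X t w)) <= disagreement (X t w).
  apply: le_trans (mixing_disagreement_le n_gt0 sW).
  rewrite -(mixing_xbar sW) /disagreement (bigD1 i) //= lerDl.
  by apply: sumr_ge0 => j _; exact: sqn_ge0.
lra.
Qed.
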